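(* Let $K/\mathbb{Q}$ be a field extension of degree five. Then there exists an algebraic unit in $K$ which is wandering under iteration of the Mahler measure $M$.
   Context: Fix an algebraic closure $\overline{\mathbb{Q}}\subseteq\mathbb{C}$ of $\mathbb{Q}$; number fields are subfields of $\overline{\mathbb{Q}}$. For $\alpha\in\overline{\mathbb{Q}}$ with (primitive) minimal polynomial $f(x)=a_nx^n+\cdots+a_0=a_n(x-\alpha_1)\cdots(x-\alpha_n)\in\mathbb{Z}[x]$ (so $f$ is irreducible in $\mathbb{Z}[x]$), the Mahler measure of $\alpha$ is $M(\alpha)=|a_n|\prod_{i=1}^n\max\{1,|\alpha_i|\}$. This is again an algebraic number, so $M$ is a map $\overline{\mathbb{Q}}\to\overline{\mathbb{Q}}$. Put $M^0(\alpha)=\alpha$ and $M^n(\alpha)=M(M^{n-1}(\alpha))$ for $n\ge1$. The point $\alpha$ is preperiodic (under iteration of $M$) if its forward orbit $\{M^n(\alpha):n\ge0\}$ is finite, and wandering if this orbit is infinite. An algebraic unit in $K$ is a unit of the ring of integers of $K$. *)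

(* Defs.v *)
From HB Require Import structures.
From mathcomp Require Import all_boot all_order all_algebra all_field.
From mathcomp Require Import boolp classical_sets cardinality.

Set Implicit Arguments.
Unset Strict Implicit.
Unset Printing Implicit Defensive.

Import Order.TTheory GRing.Theory Num.Theory.

Local Open Scope ring_scope.

(* The algebraic closure of rat inside the complex numbers is algC.  The monic
   minimal polynomial over rat is cleared of denominators and divided by its
   content; zprimitive normalizes the leading coefficient to be positive. *)
Definition int_minpoly (a : algC) : {poly int} :=
  zprimitive (projT1 (rat_poly_scale (s2val (minCpolyP a)))).

Definition conjugates (a : algC) : seq algC :=
  sval (closed_field_poly_normal (map_poly (intr : int -> algC) (int_minpoly a))).

Definition mahler (a : algC) : algC :=
  `|(lead_coef (int_minpoly a))%:~R| * \prod_(z <- conjugates a) Num.max 1 `|z|.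

Definition mahler_orbit (a : algC) : set algC :=
  [set iter n mahler a | n in [set: nat]]%classic.

Definition preperiodic (a : algC) : Prop := finite_set (mahler_orbit a).

Definition wandering (a : algC) : Prop := infinite_set (mahler_orbit a).

Definition ring_of_integers (K : fieldExtType rat) (x : K) : Prop :=
  integralOver (intr : int -> K) x.

Definition algebraic_unit (K : fieldExtType rat) (u : K) : Prop :=
  ring_of_integers u /\ exists2 v : K, ring_of_integers v & u * v = 1.

(* int_minpoly a is primitive and generates the ideal of integer polynomials
   vanishing at a, hence is irreducible over the integers. *)
Lemma int_minpolyP (a : algC) :
  [/\ zcontents (int_minpoly a) = 1,
      0 < lead_coef (int_minpoly a),
      root (map_poly intr (int_minpoly a)) a
    & forall q : {poly int}, root (map_poly (intr : int -> algC) q) a ->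
      exists r, q = int_minpoly a * r].
Proof.
rewrite /int_minpoly; case: (minCpolyP a) => p [_ mon_p] dv_p /=.
case: (rat_poly_scale p) => q0 [c nz_c Dp] /=.
have nz_q0 : q0 != 0.
  apply/eqP=> q00; have := monic_neq0 mon_p.
  by rewrite Dp q00 rmorph0 scaler0 eqxx.
have pZQC (q : {poly int}) :
    map_poly (ratr : rat -> algC) (map_poly (intr : int -> rat) q)
    = map_poly intr q.
  by rewrite -map_poly_comp; apply: eq_map_poly => z /=; rewrite ratr_int.
have nzc : zcontents q0 != 0 by rewrite zcontents_eq0.
have Eq : p %= map_poly (intr : int -> rat) (zprimitive q0).
  rewrite Dp {1}[q0]zpolyEprim map_polyZ scalerA.
  by apply: eqp_scale; rewrite mulf_neq0 ?invr_neq0 // intr_eq0.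
have con1 : zcontents (zprimitive q0) = 1 by rewrite zcontents_primitive nz_q0.
split=> //.
- by rewrite -sgz_gt0 -sgz_contents con1.
- by rewrite -pZQC dv_p (eqp_dvdl _ Eq) dvdpp.
move=> q; rewrite -pZQC dv_p (eqp_dvdl _ Eq) dvdp_rat_int.
by case/dvdpP_int=> r ->; exists r; rewrite zprimitive_id.
Qed.

(* The value does not depend on how the roots are enumerated. *)
Lemma mahlerE (a : algC) (s : seq algC) :
    map_poly intr (int_minpoly a)
      = (lead_coef (int_minpoly a))%:~R *: \prod_(z <- s) ('X - z%:P) ->
  mahler a
    = `|(lead_coef (int_minpoly a))%:~R| * \prod_(z <- s) Num.max 1 `|z|.
Proof.
rewrite /mahler /conjugates; case: closed_field_poly_normal => t /= -> Ds.
have [_ lead_gt0 _ _] := int_minpolyP a.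
have nz_l : (lead_coef (int_minpoly a))%:~R != 0 :> algC.
  by rewrite intr_eq0 gt_eqF.
congr (_ * _); apply: perm_big; apply: prod_XsubC_eq.
move: Ds; rewrite lead_coef_map_inj //; last exact: intr_inj.
exact: scalerI.
Qed.

(* Main.v *)
From HB Require Import structures.
Require Import Defs.
From mathcomp Require Import all_boot all_order all_algebra all_fingroup all_field.
From mathcomp Require Import all_solvable.
From mathcomp Require Import ring zify.
From mathcomp Require boolp classical_sets cardinality.

Set Implicit Arguments.
Unset Strict Implicit.
Unset Printing Implicit Defensive.

Import Order.TTheory GRing.Theory Num.Theory.
Local Open Scope ring_scope.

(** Suppose that exactly two of the conjugates u_0, ..., u_4 of a unit u, say
    u_0 and u_1, lie outside the unit circle, so that M(u) = |u_0 u_1|.  The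
    next iterates depend on the conjugates of u_0 u_1, that is, on the pairs of
    indices to which automorphisms can send {0, 1}.  The Galois group is
    transitive on five points, hence contains a 5-cycle, and some power of that
    5-cycle sends 0 to 1; label the conjugates so that this power is the map
    i -> i + 1 modulo 5 (five_cycle).  Then every pair {i, i + 1} is reached,
    and there are two cases.

    - If a pair of non-neighbours is reached, all ten pairs are.  Assume that
      |u_i u_j| > 1 exactly for the seven pairs that meet {0, 1}.  Then
      M(u_0 u_1) is the modulus of (u_0 u_1)^4 (u_2 u_3 u_4)^2, which is
      |u_0 u_1|^2 because the product of all u_i is a unit of Z.  The same
      computation for powers shows that the n-th iterate is |u_0 u_1| to the
      power 2^(n-1) (wandering_complete).

    - Otherwise all automorphisms act on the indices as elements of the dihedral
      group, and u_i u_(i+1) has only five conjugates.  Put W^0_i = u_i u_(i+1)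
      and W^(n+1)_i = W^n_(i-1) W^n_i W^n_(i+1).  If the conjugates of W^n_0
      outside the unit circle are those of index 4, 0 and 1, then M(W^n_0) is
      |W^(n+1)_0|.  Since the product of the five W^n_i has modulus 1, the
      moduli satisfy |W^(n+2)_i| = |W^(n+1)_i| |W^n_i| (window_rec), so that
      this sign pattern holds for all n as soon as it holds for n = 0 and
      n = 1; and then the iterates increase strictly (wandering_cyclic).

    Both cases only need |u_i u_j| > 1 and |u_i u_j u_k^2| < 1 for i in {0, 1}
    and j, k outside: the vector of the log |u_i| should point roughly in the
    direction (3, 3, -2, -2, -2).  Such units come from two applications of the
    pigeonhole principle, after choosing the pair {0, 1} stable under complex
    conjugation (conj_stable_pair).  The first gives elements of Z[theta] of
    bounded norm whose conjugates have about the sizes T^3, T^3, T^-2, T^-2,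
    T^-2 (weighted_small_poly); the second gives two of them, for very different
    values of T, that have the same norm and are congruent modulo it, so that
    their quotient is a unit (exists_weighted_unit). *)

(** * Conjugate algebraic numbers *)

Definition is_conj (x y : algC) := exists mu : {rmorphism algC -> algC}, mu x = y.

(** Automorphisms of a splitting field are transitive on the roots of an
    irreducible polynomial, and each of them extends to all of algC. *)
Lemma root_minCpoly_conj (x y : algC) : root (minCpoly x) y -> is_conj x y.
Proof.
move=> rxy; have [s Ds] := closed_field_poly_normal (minCpoly x).
rewrite (monicP (minCpoly_monic x)) scale1r in Ds.
have [Qn [QnC [s1 Ds1 genQn]]] := num_field_exists s.
have [p [Dp mon_p] dv_p] := minCpolyP x.
pose p1 := map_poly (in_alg Qn) p.
have Dp1 : map_poly QnC p1 = minCpoly x.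
  rewrite Dp -map_poly_comp; apply: eq_map_poly => a /=.
  by rewrite alg_num_field fmorph_rat.
have split_p1 : p1 = \prod_(z <- s1) ('X - z%:P).
  apply: (map_poly_inj QnC); rewrite Dp1 Ds -Ds1 big_map rmorph_prod.
  by apply: eq_bigr => z _; rewrite /= map_polyXsubC.
have splQ : SplittingField.axiom Qn.
  exists p1; first by apply/polyOver1P; exists p.
  by exists s1; rewrite ?split_p1 ?eqpxx.
pose Lm := FieldExt_isSplittingField.Build rat Qn splQ.
pose L : splittingFieldType rat := HB.pack (GRing.Field.sort Qn) Lm.
have x_s : x \in s by rewrite -root_prod_XsubC -Ds root_minCpoly.
have y_s : y \in s by rewrite -root_prod_XsubC -Ds.
move: x_s y_s; rewrite -Ds1 => /mapP[x1 x1s Dx] /mapP[y1 y1s Dy].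
have rxy1 : root (minPoly 1%AS (x1 : L)) y1.
  have /polyOver1P[q Dq] := minPolyOver 1%AS (x1 : L).
  rewrite -(fmorph_root QnC) -Dy Dq -map_poly_comp.
  have Eq : map_poly (QnC \o in_alg L) q = map_poly ratr q.
    by apply: eq_map_poly => a /=; rewrite alg_num_field fmorph_rat.
  rewrite Eq; have: root (map_poly ratr q) x.
    by rewrite -Eq map_poly_comp -Dq Dx fmorph_root root_minPoly.
  by rewrite dv_p => /dvdpP[q' ->]; rewrite rmorphM rootM /= -Dp rxy orbT.
have [g _ Dg] :=
  normalField_root_minPoly (sub1v _) (normalFieldf _) (memvf (x1 : L)) rxy1.
have [nu Dnu] := extend_algC_subfield_aut QnC (gal_repr g : {rmorphism L -> L}).
by exists nu; rewrite Dx -Dnu Dy; apply: (congr1 QnC); exact: Dg.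
Qed.

(** The roots are simple because a multiple root z would make the minimal
    polynomial of z divide its own derivative. *)
Lemma conj_roots x : exists s : seq algC,
  [/\ minCpoly x = \prod_(z <- s) ('X - z%:P), uniq s
    & forall y, y \in s <-> is_conj x y].
Proof.
have [s Ds] := closed_field_poly_normal (minCpoly x).
rewrite (monicP (minCpoly_monic x)) scale1r in Ds.
exists s; split=> //; last first.
  move=> y; rewrite -root_prod_XsubC -Ds; split.
    exact: root_minCpoly_conj.
  by case=> mu <-; rewrite -(minCpoly_aut mu x) root_minCpoly.
rewrite -separable_prod_XsubC -Ds separable_poly.unlock.
apply/Pdiv.ClosedField.coprimepP=> z pz0.
apply/negP=> p'z0.
have [p [Dp mon_p] dv_p] := minCpolyP z.
have Dz : minCpoly z = minCpoly x.
  by have [mu <-] := root_minCpoly_conj pz0; rewrite minCpoly_aut.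
have: p %| p^`() by rewrite -dv_p -deriv_map -Dp Dz.
apply/negP; have p0 := monic_neq0 mon_p.
have szp : (1 < size p)%N.
  by have := size_minCpoly z; rewrite Dp size_map_poly.
apply: contraL szp => /dvdp_leq; case: eqP => [p'0 _ | _ /(_ isT)]; last first.
  by rewrite leqNgt lt_size_deriv.
rewrite -leqNgt; case Esz: (size p) => [|[|n]] //.
have /eqP := congr1 (fun q : {poly rat} => q`_n) p'0.
rewrite coef_deriv coef0 mulrn_eq0 /= => /eqP pn0.
by move: p0; rewrite -lead_coef_eq0 lead_coefE Esz /= pn0 eqxx.
Qed.

(** With a single conjugate the minimal polynomial has degree one. *)
Lemma Crat_conj x : (forall y, is_conj x y -> y = x) -> x \in Crat.
Proof.
have [s [Ds us sP]] := conj_roots x => fix_x.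
have xs : x \in s by apply/sP; exists idfun.
have Es : s = [:: x].
  case: s {Ds} us sP xs => [|y s] //= /andP[ys us] sP _.
  have Ey : y = x by apply/fix_x/sP; rewrite inE eqxx.
  case: s ys {us} sP => [|z s] ys sP; first by rewrite Ey.
  have Ez : z = x by apply/fix_x/sP; rewrite !inE eqxx orbT.
  by rewrite Ey Ez mem_head in ys.
have [p [Dp _] _] := minCpolyP x.
rewrite Dp Es big_seq1 in Ds.
have := congr1 (fun q : {poly algC} => q`_0) Ds.
rewrite coef_map coefB coefX coefC /= sub0r => /eqP.
by rewrite eq_sym eqr_oppLR => /eqP ->; rewrite -rmorphN; apply: Crat_rat.
Qed.

(** * The Mahler measure of a family of conjugates *)

(** The primitive minimal polynomial of an algebraic integer divides a monic
    integer polynomial, so it is monic and equal to [minCpoly]. *)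
Lemma mahler_Aint (x : algC) (s : seq algC) :
    x \in Aint -> minCpoly x = \prod_(z <- s) ('X - z%:P) ->
  mahler x = \prod_(z <- s) Num.max 1 `|z|.
Proof.
move=> Zx Ds; have [_ lead_gt0 root_p dv_p] := int_minpolyP x.
have /floorpP[q Dq] : minCpoly x \is a polyOver Num.int by exact: Zx.
have mon_q : q \is monic.
  have := minCpoly_monic x; rewrite Dq !monicE lead_coef_map_inj //.
    by rewrite (eqr_int _ _ 1).
  exact: intr_inj.
have [r Dqr] : exists r, q = int_minpoly x * r.
  by apply: dv_p; rewrite -Dq root_minCpoly.
have lead1 : lead_coef (int_minpoly x) = 1.
  have : lead_coef (int_minpoly x) * lead_coef r = 1.
    by rewrite -lead_coefM -Dqr (monicP mon_q).
  move=> lr1; have := dvdz_mulr (lead_coef r) (dvdzz (lead_coef (int_minpoly x))).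
  by rewrite lr1 dvdz1; case: (lead_coef _) lead_gt0 => [[|[]]|].
apply: etrans (@mahlerE x s _) _; last by rewrite lead1 normr1 mul1r.
rewrite lead1 scale1r -Ds; apply/eqP; rewrite -eqp_monic ?minCpoly_monic //; last first.
  by rewrite monicE lead_coef_map_inj ?lead1 //; apply: intr_inj.
apply/andP; split; first by rewrite Dq Dqr rmorphM dvdp_mulr.
have ratrZ (q' : {poly int}) :
    map_poly (ratr : rat -> algC) (map_poly intr q') = map_poly intr q'.
  by rewrite -map_poly_comp; apply: eq_map_poly => b /=; rewrite ratr_int.
have [p0 [Dp0 _] dv_p0] := minCpolyP x.
by rewrite Dp0 -ratrZ dvdp_map -dv_p0 ratrZ.
Qed.

Lemma is_conj_sym x y : is_conj x y -> is_conj y x.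
Proof.
case=> mu Dy; apply: root_minCpoly_conj.
by rewrite -Dy minCpoly_aut root_minCpoly.
Qed.

(** A family f stable under all automorphisms up to a renaming of its indices
    lists the conjugates of each of its members, possibly with repetitions.  The
    subset D of indices allows families such as the products u_i u_j for
    i different from j. *)
Section ConjugateFamily.

Variables (I : finType) (D : {set I}) (f : I -> algC) (i0 : I).
Hypothesis f_perm : forall mu : {rmorphism algC -> algC}, exists sigma : I -> I,
  [/\ injective sigma, {in D, forall i, sigma i \in D}
    & {in D, forall i, mu (f i) = f (sigma i)}].

(** Renaming indices along an automorphism that sends x to y embeds the fiber
    over x in the fiber over y. *)
Lemma leq_card_fiber x y : is_conj x y ->
  (#|[set i in D | f i == x]| <= #|[set i in D | f i == y]|)%N.
Proof.
case=> mu <-; have [sigma [inj_s Ds mu_f]] := f_perm mu.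
rewrite -(card_imset _ inj_s); apply/subset_leq_card/subsetP=> _ /imsetP[i Hi ->].
by move: Hi; rewrite !inE => /andP[Di /eqP fi]; rewrite Ds //= -mu_f // fi.
Qed.

(** By symmetry of conjugacy all fibers have the same size, so the product over
    the family is a power of the product over the conjugates. *)
Lemma mahler_family :
    i0 \in D -> f i0 \in Aint -> {in D, forall i, is_conj (f i0) (f i)} ->
  mahler (f i0) ^+ #|[set i in D | f i == f i0]|
    = \prod_(i in D) Num.max 1 `|f i|.
Proof.
move=> Di0 Zf conj_f; have [s [Ds us sP]] := conj_roots (f i0).
rewrite (mahler_Aint Zf Ds) -prodrXl.
transitivity (\prod_(z <- s) \prod_(i in D | f i == z) Num.max 1 `|z|).
  apply: eq_big_seq => z /sP f0z; rewrite prodr_const; congr (_ ^+ _).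
  transitivity #|[set i in D | f i == z]|; last by rewrite cardsE.
  by apply/eqP; rewrite eqn_leq !leq_card_fiber //; apply: is_conj_sym.
rewrite (exchange_big_dep (mem D)) /=; last by move=> ? ? _ /andP[].
apply: eq_bigr => i Di; rewrite (eq_bigl (pred1 (f i))) => [|z].
  rewrite -big_filter filter_pred1_uniq ?big_seq1 //.
  exact/sP/conj_f.
by rewrite Di /= eq_sym.
Qed.

End ConjugateFamily.

(** * Units with prescribed absolute values *)

Definition ev (P : {poly int}) (x : algC) : algC := (map_poly intr P).[x].

Lemma evE n (P : {poly int}) x : (size P <= n)%N ->
  ev P x = \sum_(k < n) (P`_k)%:~R * x ^+ k.
Proof.
move=> szP; rewrite /ev (@horner_coef_wide _ n) ?size_map_inj_poly //.
  by apply: eq_bigr => k _; rewrite coef_map.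
exact: intr_inj.
Qed.

Lemma evB P Q x : ev (P - Q) x = ev P x - ev Q x.
Proof. by rewrite /ev rmorphB hornerD hornerN. Qed.

Lemma Aint_ev P x : x \in Aint -> ev P x \in Aint.
Proof.
move=> Zx; rewrite (evE _ (leqnn _)) rpred_sum // => k _.
by rewrite rpredM ?rpredX // Aint_int.
Qed.

(** A real additive form from which z can be recovered once it is known at z and
    at its conjugate.  On a set of embeddings stable under complex conjugation
    it yields one real form for each embedding, with no distinction between real
    and complex ones. *)
Definition re_plus_im (z : algC) := 'Re z + 'Im z.

Lemma re_plus_imB x y : re_plus_im (x - y) = re_plus_im x - re_plus_im y.
Proof. by rewrite /re_plus_im !raddfB /=; ring. Qed.

Lemma Rreal_re_plus_im z : re_plus_im z \is Num.real.
Proof. by rewrite rpredD ?Creal_Re ?Creal_Im. Qed.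

Lemma norm_re_plus_im z : `|re_plus_im z| <= `|z| *+ 2.
Proof.
have leRe (x : algC) : `|'Re x| <= `|x| by rewrite (leif_normC_Re_Creal x).
apply: le_trans (ler_normD _ _) _; rewrite mulr2n lerD ?leRe //.
by have := leRe ('i * z); rewrite ReMil normrN normrM normCi mul1r.
Qed.

Lemma norm_le_re_plus_im z : `|z| <= `|re_plus_im z| + `|re_plus_im z^*|.
Proof.
have E2 : (2 : algC) != 0 by rewrite pnatr_eq0.
have ReE : 'Re z = (re_plus_im z + re_plus_im z^*) / 2.
  by rewrite /re_plus_im Re_conj Im_conj; field.
have ImE : 'Im z = (re_plus_im z - re_plus_im z^*) / 2.
  by rewrite /re_plus_im Re_conj Im_conj; field.
rewrite {1}[z]Crect; apply: le_trans (ler_normD _ _) _.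
rewrite normrM normCi mul1r ReE ImE !normrM normfV normr_nat -mulrDl.
rewrite ler_pdivrMr ?ltr0n // mulr_natr mulr2n lerD ?ler_normD ?ler_normB //.
Qed.

Lemma card_notin n (S : {set 'I_n}) : #|[pred i | i \notin S]| = (n - #|S|)%N.
Proof.
transitivity #|~: S|; first by apply: eq_card => i; rewrite !inE.
by rewrite cardsCs setCK card_ord.
Qed.

(** The exponents n - |S| on S and -|S| off S are chosen to make the product of
    all weights equal to 1. *)
Definition weight n (S : {set 'I_n}) (T : nat) (i : 'I_n) : algC :=
  if i \in S then T%:R ^+ (n - #|S|) else T%:R ^- #|S|.

Lemma weight_gt0 n (S : {set 'I_n}) T i : (0 < T)%N -> 0 < weight S T i.
Proof.
by move=> T0; rewrite /weight; case: ifP => _; rewrite ?invr_gt0 exprn_gt0 ?ltr0n.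
Qed.

Lemma weightM n (S : {set 'I_n}) T1 T2 i :
  weight S (T1 * T2) i = weight S T1 i * weight S T2 i.
Proof. by rewrite /weight natrM !exprMn; case: ifP; rewrite ?invfM. Qed.

Lemma prod_weight n (S : {set 'I_n}) T : (0 < T)%N -> \prod_i weight S T i = 1.
Proof.
move=> T0; have nzT : T%:R != 0 :> algC by rewrite pnatr_eq0 -lt0n.
rewrite (bigID (mem S)) /= (eq_bigr (fun=> T%:R ^+ (n - #|S|))); last first.
  by move=> i Si; rewrite /weight Si.
rewrite [X in _ * X](eq_bigr (fun=> T%:R ^- #|S|)); last first.
  by move=> i Si; rewrite /weight (negbTE Si).
rewrite !prodr_const card_notin.
by rewrite exprVn -!exprM mulnC divff // expf_neq0.
Qed.

Lemma pigeonhole (aT rT : finType) (f : aT -> rT) : (#|rT| < #|aT|)%N ->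
  exists x, exists2 y, x != y & f x = f y.
Proof.
move=> lt_card; apply/injectivePn; apply: contraL lt_card => /injectiveP/leq_card.
by rewrite -leqNgt.
Qed.

(** There are more than N^n polynomials with coefficients between 0 and
    N = T^(n - |S|), and only M^(n - |S|) = N^n cells when the range of each of
    the n - |S| real forms attached to the indices outside S is cut in M = T^n
    intervals.  Two polynomials in the same cell have a small difference at these
    indices; the bound at the indices of S is the trivial one. *)
Lemma weighted_small_poly n (r : 'I_n -> algC) (S : {set 'I_n}) :
    (0 < n)%N ->
    {in ~: S, forall j, exists2 k, k \in ~: S & r k = (r j)^*} ->
  exists A : nat, forall T, (0 < T)%N -> exists P : {poly int},
  [/\ P != 0, (size P <= n)%N & forall i, `|ev P (r i)| <= A%:R * weight S T i].
Proof.
move=> n_gt0 conjS.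
(* The summand 1 makes the bounds strict, so that no value falls on the right
   end of the subdivided range. *)
pose B : algC := 1 + \sum_i \sum_(k < n) `|r i| ^+ k.
have sum_ge0 i : 0 <= \sum_(k < n) `|r i| ^+ k.
  by rewrite sumr_ge0 // => k _; rewrite exprn_ge0.
have B_gt0 : 0 < B by rewrite ltr_pwDl ?ltr01 // sumr_ge0.
have evB_lt N (P : {poly int}) i : (0 < N)%N -> (size P <= n)%N ->
    (forall k, `|P`_k| <= N%:Z) -> `|ev P (r i)| < N%:R * B.
  move=> N0 szP PN; apply: (@le_lt_trans _ _ (N%:R * \sum_(k < n) `|r i| ^+ k)).
    rewrite (evE _ szP) mulr_sumr; apply: le_trans (ler_norm_sum _ _ _) _.
    apply: ler_sum => k _; rewrite normrM normrX ler_wpM2r ?exprn_ge0 //.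
    by rewrite -intr_norm (ler_int _ _ N%:Z).
  rewrite ltr_pM2l ?ltr0n // (@le_lt_trans _ _ (\sum_i \sum_(k < n) `|r i| ^+ k)) //.
    by rewrite [X in _ <= X](bigD1 i) //= lerDl sumr_ge0.
  by rewrite /B ltrDr.
exists (Num.bound (B *+ 8)) => T T_gt0.
have A_ge : B *+ 8 <= (Num.bound (B *+ 8))%:R.
  by rewrite ltW // archi_boundP // mulrn_wge0 // ltW.
move: (Num.bound _) A_ge => A A_ge.
pose N := (T ^ (n - #|S|))%N; pose M := (T ^ n)%N.
have N_gt0 : (0 < N)%N by rewrite expn_gt0 T_gt0.
have M_gt0 : (0 < M)%N by rewrite expn_gt0 T_gt0.
pose pol (c : {ffun 'I_n -> 'I_N.+1}) : {poly int} := rVpoly (\row_k (c k : nat)%:Z).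
have sz_pol c : (size (pol c) <= n)%N by apply: size_poly.
have polE c (k : 'I_n) : (pol c)`_k = (c k : nat)%:Z by rewrite coef_rVpoly_ord mxE.
have pol_bnd c k : 0 <= (pol c)`_k <= N%:Z.
  rewrite coef_rVpoly; case: insub => [j|] //; rewrite mxE.
  by have := ltn_ord (c j); lia.
pose V : algC := N%:R * B *+ 2.
have V_gt0 : 0 < V by rewrite mulrn_wgt0 // mulr_gt0 ?ltr0n.
pose lin c (j : 'I_n) := re_plus_im (ev (pol c) (r j)).
have lin_real c j : lin c j \is Num.real := Rreal_re_plus_im _.
have lin_lt c j : `|lin c j| < V.
  apply: le_lt_trans (norm_re_plus_im _) _; rewrite ltr_pMn2r //.
  apply: evB_lt => // k; case/andP: (pol_bnd c k) => p0 pN; by rewrite ger0_norm.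
pose scaled c j := (lin c j + V) / (V *+ 2) * M%:R.
have scaled_itv c j : 0 <= scaled c j < M%:R.
  have := lin_lt c j; rewrite real_ltr_norml // => /andP[lo hi].
  have pos : 0 < lin c j + V by rewrite -(addNr V) ltrD2r.
  have V2_gt0 : 0 < V *+ 2 by rewrite mulrn_wgt0.
  have M0 : 0 < M%:R :> algC by rewrite ltr0n.
  apply/andP; split; first by rewrite ltW // mulr_gt0 // divr_gt0.
  by rewrite gtr_pMl // ltr_pdivrMr // mul1r mulr2n ltrD2r.
(* Reduction modulo M only serves to build an ordinal: the truncation is
   already smaller than M. *)
pose cell c : {ffun {j | j \notin S} -> 'I_M} :=
  [ffun j => Ordinal (ltn_pmod (Num.truncn (scaled c (val j))) M_gt0)].
have [|c [d neq_cd cells]] := @pigeonhole _ _ cell.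
  rewrite !card_ffun !card_ord card_sig.
  rewrite card_notin.
  by rewrite /M /N -expnM mulnC expnM ltn_exp2r.
have sz_diff : (size (pol c - pol d)%R <= n)%N.
  by rewrite (leq_trans (size_polyD _ _)) // size_polyN geq_max !sz_pol.
exists (pol c - pol d); split=> //.
- apply: contraNneq neq_cd => cd0; apply/eqP/ffunP=> k; apply: val_inj.
  have := congr1 (fun p : {poly int} => p`_k) cd0.
  by rewrite coefB !polE coef0 => /eqP; rewrite subr_eq0 => /eqP[].
move=> i; rewrite /weight; case: ifPn => [Si | nSi].
  apply: (@le_trans _ _ (N%:R * B)).
    apply/ltW/evB_lt => // k.
    have /andP[p0 pN] := pol_bnd c k; have /andP[q0 qN] := pol_bnd d k.
    rewrite coefB ler_norml lerBrDr lerBlDr (le_trans pN) ?lerDl //.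
    by rewrite (le_trans _ p0) // addrC subr_le0.
  rewrite mulrC /N natrX ler_wpM2r ?exprn_ge0 // (le_trans _ A_ge) //.
  by rewrite mulrS lerDl mulrn_wge0 // ltW.
have near j : j \notin S -> `|re_plus_im (ev (pol c - pol d) (r j))| * M%:R <= V *+ 2.
  move=> nSj; have := congr1 (fun g : {ffun _ -> 'I_M} => val (g (Sub j nSj))) cells.
  have [/andP[c0 cM] /andP[d0 dM]] := (scaled_itv c j, scaled_itv d j).
  rewrite !ffunE /= !modn_small ?truncn_lt_nat // => Etr.
  have := truncn_itv c0; have := truncn_itv d0; rewrite Etr.
  set t := Num.truncn _ => /andP[dl dh] /andP[cl ch].
  have : `|scaled c j - scaled d j| <= 1.
    rewrite real_ler_norml ?realB ?ger0_real //; apply/andP; split.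
      by rewrite lerBrDr addrC lerBlDr (le_trans (ltW dh)) // -natr1 lerD2r.
    by rewrite lerBlDr (le_trans (ltW ch)) // -natr1 addrC lerD2l.
  rewrite evB re_plus_imB -/(lin c j) -/(lin d j).
  have -> : scaled c j - scaled d j = (lin c j - lin d j) * M%:R / (V *+ 2).
    by rewrite /scaled -!mulrBl opprD addrACA subrr addr0 mulrAC.
  have V2_gt0 : 0 < V *+ 2 by rewrite mulrn_wgt0.
  by rewrite !normrM normfV (gtr0_norm V2_gt0) ler_pdivrMr // mul1r normr_nat.
have nSi' : i \in ~: S by rewrite inE.
have [k nSk Dk] := conjS i nSi'.
have evk : ev (pol c - pol d) (r k) = (ev (pol c - pol d) (r i))^*.
  rewrite /ev Dk -horner_map -map_poly_comp; congr (_.[_]); apply: eq_map_poly => z.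
  by rewrite /= rmorph_int.
rewrite ler_pdivlMr ?exprn_gt0 ?ltr0n //.
rewrite -(ler_pM2r (_ : 0 < N%:R)) ?ltr0n // -mulrA.
have -> : T%:R ^+ #|S| * N%:R = M%:R :> algC.
  by rewrite /N /M !natrX -exprD subnKC // -[X in (_ <= X)%N]card_ord max_card.
apply: (@le_trans _ _ (B *+ 8 * N%:R)); last by rewrite ler_wpM2r.
apply: (@le_trans _ _ (V *+ 2 + V *+ 2)); last first.
  by rewrite /V -!mulrnDr -!mulrnA mulrC mulrnAl; exact: lexx.
apply: le_trans (lerD (near i nSi) (near k _)); last by rewrite -in_setC.
by rewrite -mulrDl ler_wpM2r // evk norm_le_re_plus_im.
Qed.

(** The lower bound for one factor comes from the upper bounds for all the
    others, as in Liouville's inequality. *)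
Lemma weight_le_of_prod n (b x : 'I_n -> algC) (A : algC) i :
    (forall j, 0 < b j) -> (forall j, 0 <= x j <= A * b j) -> \prod_j b j = 1 ->
  1 <= \prod_j x j -> 1 <= A -> b i <= A ^+ n * x i.
Proof.
move=> b_gt0 xb b1 x1 A1; have A_gt0 := lt_le_trans ltr01 A1.
have x_ge0 : 0 <= x i by case/andP: (xb i).
apply: (@le_trans _ _ (b i * \prod_j x j)); first by rewrite (ler_peMr (ltW (b_gt0 i))).
rewrite (bigD1 i) //= mulrCA mulrC ler_wpM2r //.
have -> : A ^+ n = \prod_j (A * b j).
  by rewrite big_split /= b1 mulr1 prodr_const card_ord.
rewrite [X in _ <= X](bigD1 i) //=; apply: ler_pM; first exact: ltW.
- by apply: prodr_ge0 => j _; case/andP: (xb j).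
- by rewrite (ler_peMl (ltW (b_gt0 i))).
by apply: ler_prod => j _.
Qed.

(** The r_i are the conjugates of an algebraic integer theta of degree n, and
    [ev P (r i)] those of the element P(theta) of Z[theta]. *)
Section Units.

Variables (n : nat) (r : 'I_n -> algC).
Hypothesis Zr : forall i, r i \in Aint.
Hypothesis r_perm : forall mu : {rmorphism algC -> algC},
  exists2 s : 'I_n -> 'I_n, injective s & forall i, mu (r i) = r (s i).
Hypothesis r_free : forall (P : {poly int}) i,
  P != 0 -> (size P <= n)%N -> ev P (r i) != 0.

Lemma ev_aut (mu : {rmorphism algC -> algC}) P x : mu (ev P x) = ev P (mu x).
Proof.
rewrite /ev -horner_map -map_poly_comp; congr (_.[_]).
by apply: eq_map_poly => z; rewrite /= rmorph_int.
Qed.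

Definition ev_norm P := \prod_i ev P (r i).

(** An algebraic integer fixed by all automorphisms is an integer. *)
Lemma int_ev_norm P : ev_norm P \in Num.int.
Proof.
apply: Cint_rat_Aint; last by apply: rpred_prod => i _; apply: Aint_ev.
apply: Crat_conj => _ [mu <-]; have [s s_inj sE] := r_perm mu.
rewrite rmorph_prod /ev_norm /= [RHS](reindex_inj s_inj).
by apply: eq_bigr => i _; rewrite ev_aut sE.
Qed.

(** If P = Q + m D, where m is up to sign the norm of Q(theta), then P / Q is
    1 + D (m / Q), and m / Q is up to sign the product of the other conjugates
    of Q. *)
Lemma Aint_ev_div P Q D : (forall i, ev Q (r i) != 0) ->
    P - Q = D * (Num.truncn `|ev_norm Q|)%:R ->
  forall i, ev P (r i) / ev Q (r i) \in Aint.
Proof.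
move=> nzQ DPQ i; set m := Num.truncn _ in DPQ.
have mE : m%:R = `|ev_norm Q| by rewrite truncnK // natr_norm_int // int_ev_norm.
have -> : ev P (r i) = ev Q (r i) + ev D (r i) * m%:R.
  rewrite -[P](subrK Q) DPQ addrC /ev rmorphD hornerD; congr (_ + _).
  by rewrite rmorphM hornerM rmorph_nat -polyC_natr hornerC.
rewrite mulrDl divff // -mulrA rpredD // rpredM ?Aint_ev //.
have [e Ze ->] : exists2 e : algC, e \in Aint & m%:R = e * ev_norm Q.
  have := Rreal_int (int_ev_norm Q).
  rewrite mE realE => /orP[/ger0_norm|/ler0_norm]->.
    by exists 1; rewrite ?mul1r.
  by exists (-1); rewrite ?mulN1r ?rpredN.
rewrite -mulrA rpredM // /ev_norm (bigD1 i) //= mulrAC divff // mul1r.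
by apply: rpred_prod => j _; apply: Aint_ev.
Qed.

Lemma norm_unitE P Q : (forall i, ev Q (r i) != 0) -> `|ev_norm P| = `|ev_norm Q| ->
  \prod_i `|ev P (r i) / ev Q (r i)| = 1.
Proof.
move=> nzQ eqPQ; under eq_bigr do rewrite normf_div.
rewrite prodf_div -!normr_prod -/(ev_norm P) eqPQ divff //.
by rewrite normr_eq0; apply/prodf_neq0.
Qed.

(** The small elements F_k obtained for T = (B+2)^k have bounded norms, so two of
    them, for indices l < k, have the same norm N and the same residue modulo N.
    Each of the two quotients is then integral.  Since no conjugate of F_l is
    much smaller than its weight, the quotient F_k / F_l has the weight of
    (B+2)^(k - l), up to a constant independent of B. *)
Lemma exists_weighted_unit (S : {set 'I_n}) : (0 < n)%N ->
    {in ~: S, forall j, exists2 k, k \in ~: S & r k = (r j)^*} ->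
  exists C : nat, forall B : nat, exists2 T, (B < T)%N &
  exists P Q : {poly int},
  [/\ forall i, ev P (r i) != 0 /\ ev Q (r i) != 0,
      forall i, ev P (r i) / ev Q (r i) \in Aint,
      forall i, ev Q (r i) / ev P (r i) \in Aint,
      \prod_i `|ev P (r i) / ev Q (r i)| = 1
    & forall i, let x := `|ev P (r i) / ev Q (r i)| in
      x <= C%:R * weight S T i /\ weight S T i <= C%:R * x].
Proof.
move=> n_gt0 conjS; have [A0 smallP] := weighted_small_poly n_gt0 conjS.
pose A := A0.+1; exists (A ^ n.+1)%N => B.
pose G k := (B.+2 ^ k)%N; have G_gt0 k : (0 < G k)%N by rewrite expn_gt0.
have [F FP] := boolp.choice (fun k => smallP (G k) (G_gt0 k)).
have nzF k i : ev (F k) (r i) != 0 by case: (FP k) => nz sz _; apply: r_free.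
have A1 : 1 <= A%:R :> algC by rewrite ler1n.
have A_gt0 : 0 < A%:R :> algC by rewrite ltr0n.
have w_gt0 T i : (0 < T)%N -> 0 < weight S T i by apply: weight_gt0.
have F_le k i : 0 <= `|ev (F k) (r i)| <= A%:R * weight S (G k) i.
  case: (FP k) => _ _ /(_ i) le_F; rewrite normr_ge0 (le_trans le_F) //.
  by rewrite ler_wpM2r ?ler_nat ?ltW ?w_gt0.
pose N k := Num.truncn `|ev_norm (F k)|.
have NE k : (N k)%:R = `|ev_norm (F k)|.
  by rewrite truncnK // natr_norm_int // int_ev_norm.
have N_gt0 k : (0 < N k)%N.
  rewrite -(ltr0n algC) NE normr_gt0; exact/prodf_neq0.
have N_le k : (N k <= A ^ n)%N.
  rewrite -(ler_nat algC) NE /ev_norm normr_prod natrX.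
  have -> : A%:R ^+ n = \prod_i (A%:R * weight S (G k) i) :> algC.
    by rewrite big_split /= prod_weight // mulr1 prodr_const card_ord.
  by apply: ler_prod => i _.
have F_ge k i : weight S (G k) i <= A%:R ^+ n * `|ev (F k) (r i)|.
  apply: (weight_le_of_prod (b := weight S (G k))
                            (x := fun i => `|ev (F k) (r i)|)) => //.
  - by move=> j; apply: w_gt0.
  - exact: prod_weight.
  by rewrite -normr_prod -/(ev_norm _) -NE ler1n.
(* Only the coefficients of index below n matter, and N_k <= A^n bounds both
   the norm and the residues. *)
pose key k : 'I_(A ^ n).+1 * {ffun 'I_n -> 'I_(A ^ n).+1} :=
  (inord (N k), [ffun i : 'I_n => inord `|((F k)`_i %% (N k)%:Z)%Z|%N]).
have [|k0 [l0 neq_kl0 key_kl0]] :=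
    @pigeonhole 'I_(#|{: 'I_(A ^ n).+1 * {ffun 'I_n -> 'I_(A ^ n).+1}}|.+1) _
      (fun k => key k).
  by rewrite [X in (_ < X)%N]card_ord.
have [k [l [lt_lk key_kl]]] : exists k l : nat, (l < k)%N /\ key k = key l.
  case: (ltngtP k0 l0) neq_kl0 => [lt|lt|/val_inj->]; last by rewrite eqxx.
    by exists l0, k0.
  by exists k0, l0.
have eqN : N k = N l.
  by case: key_kl => /(congr1 val) /=; rewrite !inordK ?ltnS.
have Nz : (N l)%:Z != 0 by rewrite gt_eqF // ltz_nat.
have eq_mod i : (F k)`_i = (F l)`_i %[mod (N l)%:Z]%Z.
  have [ge_i|lt_i] := leqP n i.
    have [[_ szk _] [_ szl _]] := (FP k, FP l).
    by rewrite !nth_default // (leq_trans _ ge_i).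
  case: key_kl => _ /ffunP/(_ (Ordinal lt_i))/(congr1 val); rewrite !ffunE /= eqN.
  have bnd z : (`|(z %% (N l)%:Z)%Z| < (A ^ n).+1)%N.
    have := modz_ge0 z Nz; have := ltz_pmod z (N_gt0 l : 0 < (N l)%:Z).
    by have := N_le l; lia.
  rewrite !inordK // => /(congr1 Posz); rewrite !gez0_abs ?modz_ge0 //.
have diffE (P Q : {poly int}) : (forall i, P`_i = Q`_i %[mod (N l)%:Z]%Z) ->
    exists D, P - Q = D * (N l)%:R.
  move=> PQ; exists (map_poly (fun z => z %/ (N l)%:Z)%Z (P - Q)).
  apply/polyP=> i; rewrite -polyC_natr coefMC coef_map_id0 ?div0z //.
  rewrite natz divzK // coefB -eqz_mod_dvd; exact/eqP.
have [D1 E1] := diffE _ _ eq_mod.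
have [D2 E2] := diffE _ _ (fun i => esym (eq_mod i)).
exists (B.+2 ^ (k - l))%N.
  apply: (@leq_trans (B.+2 ^ 1)); first by rewrite expn1.
  by rewrite leq_exp2l // subn_gt0.
exists (F k), (F l); split=> [i||||i].
- by rewrite !nzF.
- exact: Aint_ev_div E1.
- by apply: Aint_ev_div (_ : _ = D2 * _) => //; rewrite -/(N k) eqN.
- by apply: norm_unitE => //; rewrite -!NE eqN.
have GE : G k = (B.+2 ^ (k - l) * G l)%N by rewrite -expnD subnK // ltnW.
set T := (B.+2 ^ (k - l))%N in GE *; have T_gt0 : (0 < T)%N by rewrite expn_gt0.
have Fl_gt0 : 0 < `|ev (F l) (r i)| by rewrite normr_gt0.
rewrite /= normf_div natrX exprS.
have /andP[_ lek] := F_le k i; have /andP[_ lel] := F_le l i.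
have gek := F_ge k i; have gel := F_ge l i; rewrite GE weightM in lek gek.
split.
  rewrite ler_pdivrMr // (le_trans lek) // -!mulrA (ler_wpM2l (ltW A_gt0)) //.
  by rewrite mulrCA (ler_wpM2l (ltW (w_gt0 _ _ _))).
rewrite mulrA ler_pdivlMr //.
apply: (@le_trans _ _ (A%:R * (weight S T i * weight S (G l) i))); last first.
  by rewrite -mulrA (ler_wpM2l (ltW A_gt0)).
by rewrite mulrCA (ler_wpM2l (ltW (w_gt0 _ _ _))).
Qed.

End Units.

(** * Iterating the Mahler measure on five conjugates *)

Lemma mahlerN x : x \in Aint -> mahler (- x) = mahler x.
Proof.
move=> Zx; have [s [Ds us sP]] := conj_roots x.
have [t [Dt ut tP]] := conj_roots (- x).
rewrite (mahler_Aint Zx Ds) (mahler_Aint _ Dt) ?rpredN //.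
rewrite (perm_big (map -%R s)) /=.
  by rewrite big_map; apply: eq_bigr => z _; rewrite normrN.
apply: uniq_perm => //; first by rewrite map_inj_uniq //; apply: oppr_inj.
move=> z; rewrite -[z]opprK mem_map; last exact: oppr_inj.
apply/idP/idP => [/tP | /sP] [mu Dmu].
  by apply/sP; exists mu; rewrite -[x in LHS]opprK rmorphN Dmu opprK.
by apply/tP; exists mu; rewrite rmorphN Dmu.
Qed.

Lemma mahler_norm_real x : x \in Aint -> x \is Num.real -> mahler `|x| = mahler x.
Proof.
by move=> Zx; rewrite realE => /orP[/ger0_norm-> | /ler0_norm->] //; rewrite mahlerN.
Qed.

Lemma wandering_increasing x (g : nat -> algC) :
    (forall n, g n < g n.+1) -> (forall n, iter n.+1 mahler x = g n) ->
  wandering x.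
Proof.
move=> g_incr itE.
have g_mono : {homo g : m n / (m < n)%N >-> m < n}.
  by apply: homo_ltn => //; apply: lt_trans.
have g_inj : injective g.
  move=> m n Eg; case: (ltngtP m n) => // /g_mono; by rewrite Eg ltxx.
move=> fin_orbit; apply: cardinality.infinite_nat.
have : cardinality.finite_set (classical_sets.preimage g (mahler_orbit x)).
  by apply: cardinality.finite_preimage fin_orbit => m n _ _; apply: g_inj.
by apply: cardinality.sub_finite_set => n _; exists n.+1; rewrite ?itE.
Qed.

Lemma ord5P (P : 'I_5 -> Prop) :
  P 0 -> P 1 -> P 2 -> P 3 -> P 4 -> forall i, P i.
Proof.
move=> P0 P1 P2 P3 P4 [[|[|[|[|[|//]]]]] lti].
- by rewrite (_ : Ordinal lti = 0) //; apply: val_inj.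
- by rewrite (_ : Ordinal lti = 1) //; apply: val_inj.
- by rewrite (_ : Ordinal lti = 2) //; apply: val_inj.
- by rewrite (_ : Ordinal lti = 3) //; apply: val_inj.
by rewrite (_ : Ordinal lti = 4) //; apply: val_inj.
Qed.

Lemma prod_ord5 (F : 'I_5 -> algC) :
  \prod_i F i = F 0 * F 1 * F 2 * F 3 * F 4.
Proof.
rewrite !big_ord_recl big_ord0 mulr1 !mulrA.
by congr (F _ * F _ * F _ * F _ * F _); apply: val_inj.
Qed.

Lemma max1_gt1 (x : algC) : 1 < x -> Num.max 1 x = x.
Proof. by move=> x_gt1; rewrite /Order.max x_gt1. Qed.

Lemma max1_lt1 (x : algC) : x < 1 -> Num.max 1 x = 1.
Proof. by move=> x_lt1; rewrite /Order.max (lt_gtF x_lt1). Qed.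

(** The u_i are the conjugates of a unit of degree five, labelled so that some
    automorphism acts as i -> i + 1, and log |u_i| points roughly in the
    direction (3, 3, -2, -2, -2). *)
Section SignPattern.

Variable u : 'I_5 -> algC.
Hypothesis u_perm : forall mu : {rmorphism algC -> algC},
  exists2 s : 'I_5 -> 'I_5, injective s & forall i, mu (u i) = u (s i).
Variable nu : {rmorphism algC -> algC}.
Hypothesis nuE : forall i, nu (u i) = u (i + 1).
Hypothesis Zu : forall i, u i \in Aint.
Hypothesis prod_abs_u : \prod_i `|u i| = 1.
Hypothesis mixed_gt1 : forall i j : 'I_5, (i < 2)%N -> (2 <= j)%N ->
  1 < `|u i| * `|u j|.
Hypothesis skewed_lt1 : forall i j k : 'I_5, (i < 2)%N -> (2 <= j)%N -> (2 <= k)%N ->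
  `|u i| * `|u j| * `|u k| ^+ 2 < 1.

Lemma small_lt1 (k : 'I_5) : (2 <= k)%N -> `|u k| < 1.
Proof.
move=> k2; rewrite -(@expr_lt1 _ 2) //.
apply: le_lt_trans (skewed_lt1 (i := 0) (j := 2) _ _ k2) => //.
by rewrite ler_peMl ?exprn_ge0 // ltW // mixed_gt1.
Qed.

Lemma big_gt1 (i : 'I_5) : (i < 2)%N -> 1 < `|u i|.
Proof.
move=> i2; apply: lt_le_trans (mixed_gt1 (j := 2) i2 _) _ => //.
by rewrite ler_piMr // ltW // small_lt1.
Qed.

Lemma shift_aut k : exists mu : {rmorphism algC -> algC}, forall i, mu (u i) = u (i + k).
Proof.
rewrite -[k]natr_Zp; elim: (val k) => [|m [mu muE]].
  by exists idfun => i; rewrite addr0.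
by exists (nu \o mu) => i; rewrite /= muE nuE -natr1 addrA.
Qed.

(** An equality u_0 = u_d propagates along the 5-cycle, whereas |u_0| differs
    from |u_2|. *)
Lemma u_inj : injective u.
Proof.
have eq_shift i j k : u i = u j -> u (i + k) = u (j + k).
  by have [mu muE] := shift_aut k => Eij; rewrite -!muE Eij.
have sep (i j : 'I_5) : (i < 2)%N -> (2 <= j)%N -> u i <> u j.
  move=> lti lej Eij; have := big_gt1 lti; rewrite Eij => /lt_trans/(_ (small_lt1 lej)).
  by rewrite ltxx.
have d0 d : u 0 = u d -> d = 0.
  elim/ord5P: d => // E0.
  - have := eq_shift _ _ 1 E0; rewrite add0r -E0 => E.
    by case: (sep 0 2).
  - by case: (sep 0 2).
  - by case: (sep 0 3).
  by case: (sep 0 4).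
move=> i j /(eq_shift _ _ (- i)); rewrite subrr => /d0/eqP.
by rewrite subr_eq0 => /eqP.
Qed.

Lemma mahler_start i : mahler (u i) = `|u 0| * `|u 1|.
Proof.
have f_perm (mu : {rmorphism algC -> algC}) : exists s : 'I_5 -> 'I_5,
    [/\ injective s, {in [set: 'I_5], forall i, s i \in [set: 'I_5]}
      & {in [set: 'I_5], forall i, mu (u i) = u (s i)}].
  by have [s s_inj sE] := u_perm mu; exists s; split=> // j _; rewrite ?inE.
have := mahler_family f_perm (in_setT i) (Zu i).
rewrite (_ : [set j in _ | _] = [set i]) ?cards1 ?expr1; last first.
  by apply/setP=> j; rewrite !inE (inj_eq u_inj).
move=> -> => [|j _]; last first.
  have [mu muE] := shift_aut (j - i); exists mu; by rewrite muE addrC subrK.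
transitivity (\prod_j Num.max 1 `|u j|).
  by apply: eq_bigl => j; rewrite inE.
have maxb (k : 'I_5) : (k < 2)%N -> Num.max 1 `|u k| = `|u k|.
  by move=> /big_gt1/max1_gt1.
have maxs (k : 'I_5) : (2 <= k)%N -> Num.max 1 `|u k| = 1.
  by move=> /small_lt1/max1_lt1.
by rewrite prod_ord5 (maxb 0) // (maxb 1) // (maxs 2) // (maxs 3) // (maxs 4) // !mulr1.
Qed.

Lemma pair_max (i j : 'I_5) : i != j -> (2 <= i)%N || (2 <= j)%N ->
  `|u i| * `|u j| < `|u 0| * `|u 1|.
Proof.
wlog le_ij: i j / (i <= j)%N => [IH ij|].
  case: (leqP i j) => [/IH|/ltnW/IH]; first exact.
  by rewrite mulrC orbC eq_sym; apply.
move=> _ i2j2; have j2 : (2 <= j)%N by case/orP: i2j2 => // /leq_trans; apply.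
have y_gt1 : 1 < `|u 0| * `|u 1| by rewrite mulr_egt1 ?big_gt1.
have [i1 | i2] := ltnP i 2; last first.
  by apply: lt_trans y_gt1; rewrite mulr_ilt1 ?small_lt1.
apply: (@lt_trans _ _ (`|u i|)).
  by rewrite gtr_pMr ?small_lt1 // (lt_trans ltr01) ?big_gt1.
have a_gt0 (k : 'I_5) : (k < 2)%N -> 0 < `|u k| by move/big_gt1/(lt_trans ltr01).
have [->|->] : i = 0 \/ i = 1 by move: i1; elim/ord5P: i {i2j2 le_ij}; auto.
  by rewrite ltr_pMr ?a_gt0 ?big_gt1.
by rewrite ltr_pMl ?a_gt0 ?big_gt1.
Qed.

(** Complex conjugation permutes the family and preserves moduli, so it fixes the
    member of largest modulus. *)
Lemma real_unique_max (I : finType) (f : I -> algC) i0 :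
    (forall mu : {rmorphism algC -> algC}, exists s : I -> I,
      forall i, mu (f i) = f (s i)) ->
    (forall i, i != i0 -> `|f i| < `|f i0|) -> f i0 \is Num.real.
Proof.
move=> f_perm f_max; have [s sE] := f_perm Num.conj.
rewrite CrealE; apply/eqP; rewrite sE.
have [-> //|ne] := eqVneq (s i0) i0.
have := f_max _ ne; by rewrite -sE norm_conjC ltxx.
Qed.

(** In the dihedral case the iterate of order n + 1 is the modulus of
    [window n 0].  The exponents of the u_j in [window n i] come from n-fold
    convolution with the indicator function of {-1, 0, 1} on Z/5. *)
Fixpoint window (n : nat) (i : 'I_5) : algC :=
  if n is n'.+1 then window n' (i - 1) * window n' i * window n' (i + 1)
  else u i * u (i + 1).

Lemma window_shift k : exists mu : {rmorphism algC -> algC},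
  forall n i, mu (window n i) = window n (i + k).
Proof.
have [mu muE] := shift_aut k; exists mu; elim=> [|n IH] i /=.
  by rewrite rmorphM !muE addrAC.
by rewrite !rmorphM !IH /= (addrAC i (- 1)) (addrAC i 1).
Qed.

Lemma prod_shift (F : 'I_5 -> algC) k : \prod_i F (i + k) = \prod_i F i.
Proof. by rewrite [RHS](reindex_inj (addIr k)). Qed.

Lemma prod_window n : \prod_i `|window n i| = 1.
Proof.
elim: n => [|n IH] /=.
  under eq_bigr do rewrite normrM.
  by rewrite big_split /= (prod_shift (fun i => `|u i|)) prod_abs_u mulr1.
under eq_bigr do rewrite !normrM.
by rewrite !big_split /= !(prod_shift (fun i => `|window n i|)) IH !mulr1.
Qed.

Local Notation w n i := `|window n i|.

Lemma windowS n (i : 'I_5) : w n.+1 i = w n (i - 1) * w n i * w n (i + 1).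
Proof. by rewrite /= !normrM. Qed.

Lemma prod_window5 n (i : 'I_5) :
  w n (i - 2) * w n (i - 1) * w n i * w n (i + 1) * w n (i + 2) = 1.
Proof.
rewrite -[RHS](prod_window n) -(prod_shift _ i) prod_ord5 add0r.
have <- : 4 + i = i - 1 by rewrite addrC; congr (_ + _); apply: val_inj.
have <- : 3 + i = i - 2 by rewrite addrC; congr (_ + _); apply: val_inj.
by rewrite (addrC i 1) (addrC i 2); ring.
Qed.

(** On Z/5, convolving twice with the indicator of {-1, 0, 1} gives the
    multiplicities 1, 2, 3, 2, 1 at -2, ..., 2.  Removing one copy of the whole
    of Z/5, which contributes a factor 1, leaves 0, 1, 2, 1, 0: a single
    convolution plus the identity. *)
Lemma window_rec n (i : 'I_5) : w n.+2 i = w n.+1 i * w n i.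
Proof.
have E1 : i - 1 - 1 = i - 2 :> 'I_5 by rewrite -addrA; congr (_ + _); apply: val_inj.
have E2 : i + 1 + 1 = i + 2 :> 'I_5 by rewrite -addrA; congr (_ + _); apply: val_inj.
rewrite /= !normrM !subrK !addrK E1 E2.
transitivity ((w n (i - 2) * w n (i - 1) * w n i * w n (i + 1) * w n (i + 2))
  * (w n (i - 1) * w n i * w n (i + 1) * w n i)); first by ring.
by rewrite prod_window5 mul1r.
Qed.

Lemma w_gt0 n i : 0 < w n i.
Proof.
have : \prod_i w n i != 0 by rewrite prod_window oner_neq0.
rewrite prodf_seq_neq0 => /allP/(_ i).
by rewrite mem_index_enum normr_gt0 normr_eq0; apply.
Qed.

(** The three factors of [window n.+1 i] are complementary to the two at
    distance 2 from i. *)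
Lemma windowSE n (i : 'I_5) : w n.+1 i * (w n (i - 2) * w n (i + 2)) = 1.
Proof. by rewrite -(prod_window5 n i) /= !normrM; ring. Qed.

(** The sign pattern of the cosine of 2 pi i / 5, an eigenvector of the
    convolution whose eigenvalue, the golden ratio, is dominant on the vectors
    of sum zero. *)
Definition pattern n := [/\ 1 < w n 0, 1 < w n 1, 1 < w n 4, w n 2 < 1 & w n 3 < 1].

Lemma pattern0 : pattern 0.
Proof.
have E2 : (1 + 1 : 'I_5) = 2 by apply: val_inj.
have E3 : (2 + 1 : 'I_5) = 3 by apply: val_inj.
have E4 : (3 + 1 : 'I_5) = 4 by apply: val_inj.
have E0 : (4 + 1 : 'I_5) = 0 by apply: val_inj.
rewrite /pattern /= !normrM add0r E2 E3 E4 E0; split.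
- by rewrite mulr_egt1 ?big_gt1.
- exact: mixed_gt1.
- by rewrite mulrC mixed_gt1.
- by rewrite mulr_ilt1 ?small_lt1.
by rewrite mulr_ilt1 ?small_lt1.
Qed.

Lemma gt1_of_mul1 (x y : algC) : 0 < y -> x * y = 1 -> (1 < x) = (y < 1).
Proof. by move=> y_gt0 xy; rewrite -[1 < x](ltr_pM2r y_gt0) xy mul1r. Qed.

Lemma lt1_of_mul1 (x y : algC) : 0 < y -> x * y = 1 -> (x < 1) = (1 < y).
Proof. by move=> y_gt0 xy; rewrite -[x < 1](ltr_pM2r y_gt0) xy mul1r. Qed.

(** Here |u_i u_j u_k^2| < 1 is needed: the complement of the window around 1
    is made of u_3 u_4 and u_4 u_0, the one around 4 of u_2 u_3 and u_1 u_2. *)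
Lemma pattern1 : pattern 1.
Proof.
have ww_gt0 i j : 0 < w 0 i * w 0 j by rewrite mulr_gt0 ?w_gt0.
have [w0 w1 w4 w2 w3] := pattern0.
split.
- rewrite (gt1_of_mul1 (ww_gt0 _ _) (windowSE 0 0)).
  rewrite (_ : 0 - 2 = 3 :> 'I_5); last exact: val_inj.
  rewrite (_ : 0 + 2 = 2 :> 'I_5); last exact: val_inj.
  by rewrite mulr_ilt1.
- rewrite (gt1_of_mul1 (ww_gt0 _ _) (windowSE 0 1)).
  rewrite (_ : 1 - 2 = 4 :> 'I_5); last exact: val_inj.
  rewrite (_ : 1 + 2 = 3 :> 'I_5) /=; last exact: val_inj.
  rewrite !normrM (_ : 4 + 1 = 0 :> 'I_5); last exact: val_inj.
  rewrite (_ : 3 + 1 = 4 :> 'I_5); last exact: val_inj.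
  by have := @skewed_lt1 0 3 4 isT isT isT; congr (_ < 1); ring.
- rewrite (gt1_of_mul1 (ww_gt0 _ _) (windowSE 0 4)).
  rewrite (_ : 4 - 2 = 2 :> 'I_5); last exact: val_inj.
  rewrite (_ : 4 + 2 = 1 :> 'I_5) /=; last exact: val_inj.
  rewrite !normrM (_ : 2 + 1 = 3 :> 'I_5); last exact: val_inj.
  rewrite (_ : 1 + 1 = 2 :> 'I_5); last exact: val_inj.
  by have := @skewed_lt1 1 3 2 isT isT isT; congr (_ < 1); ring.
- rewrite (lt1_of_mul1 (ww_gt0 _ _) (windowSE 0 2)).
  rewrite (_ : 2 - 2 = 0 :> 'I_5); last exact: val_inj.
  rewrite (_ : 2 + 2 = 4 :> 'I_5); last exact: val_inj.
  by rewrite mulr_egt1.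
rewrite (lt1_of_mul1 (ww_gt0 _ _) (windowSE 0 3)).
rewrite (_ : 3 - 2 = 1 :> 'I_5); last exact: val_inj.
rewrite (_ : 3 + 2 = 0 :> 'I_5); last exact: val_inj.
by rewrite mulr_egt1.
Qed.

Lemma patternP n : pattern n.
Proof.
suff [] : pattern n /\ pattern n.+1 by [].
elim: n => [|n [Pn PSn]]; first by split; [exact: pattern0 | exact: pattern1].
split=> //; case: Pn PSn => [x0 x1 x4 x2 x3] [y0 y1 y4 y2 y3].
by split; rewrite window_rec ?mulr_egt1 ?mulr_ilt1 ?normr_ge0.
Qed.

(** Like the sign pattern, this propagates along [window_rec] from the first two
    levels. *)
Lemma window_max n i : i != 0 -> w n i < w n 0.
Proof.
move=> i0; have [w0 w1 w4 w2 w3] := patternP 0.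
suff [] : w n i < w n 0 /\ w n.+1 i < w n.+1 0 by [].
elim: n => [|n [IHn IHSn]]; last first.
  by split=> //; rewrite !window_rec ltr_pM // ?ltW ?w_gt0.
split.
  rewrite /= !normrM add0r.
  elim/ord5P: i i0 => // _.
  - exact: pair_max.
  - exact: pair_max.
  - exact: pair_max.
  exact: pair_max.
have [v0 v1 v4 v2 v3] := patternP 1.
elim/ord5P: i i0 => // _; try by apply: lt_trans v0.
  rewrite !windowS subrr !add0r (_ : - 1 = 4 :> 'I_5); last exact: val_inj.
  rewrite (_ : 1 + 1 = 2 :> 'I_5); last exact: val_inj.
  rewrite mulrC -[X in _ < X]mulrA ltr_pM2r ?mulr_gt0 ?w_gt0 //.
  exact: lt_trans w2 w4.
rewrite !windowS !add0r (_ : - 1 = 4 :> 'I_5); last exact: val_inj.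
rewrite (_ : 4 + 4 = 3 :> 'I_5); last exact: val_inj.
rewrite (_ : 4 + 1 = 0 :> 'I_5); last exact: val_inj.
rewrite -[X in X < _]mulrA [X in _ < X]mulrC ltr_pM2r ?mulr_gt0 ?w_gt0 //.
exact: lt_trans w3 w1.
Qed.

Lemma Aint_window n i : window n i \in Aint.
Proof. by elim: n i => [|n IH] i; rewrite /= !rpredM. Qed.

Section Cyclic.

Hypothesis adjacent : forall (mu : {rmorphism algC -> algC}) (s : 'I_5 -> 'I_5),
  (forall i, mu (u i) = u (s i)) -> s 1 - s 0 = 1 \/ s 1 - s 0 = - 1.

(** Neighbours go to neighbours, so the step from s(k) to s(k+1) is 1 or -1, and
    injectivity forbids a change of direction. *)
Lemma dihedral (mu : {rmorphism algC -> algC}) : exists c e : 'I_5,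
  (e = 1 \/ e = -1) /\ forall i, mu (u i) = u (c + e * i).
Proof.
have [s s_inj sE] := u_perm mu; exists (s 0), (s 1 - s 0).
split; first exact: adjacent sE.
have step k : s (k + 1) - s k = 1 \/ s (k + 1) - s k = - 1.
  have [nuk nukE] := shift_aut k.
  rewrite [k + 1]addrC -[in s k](add0r k).
  by apply: (@adjacent (mu \o nuk) (fun i => s (i + k))) => i /=; rewrite nukE sE.
have stepE k : s (k + 1 + 1) - s (k + 1) = s (k + 1) - s k.
  have neq : s (k + 1 + 1) <> s k.
    move/s_inj/eqP; rewrite -addrA -subr_eq0 addrAC subrr add0r.
    by move/eqP/(congr1 val).
  have := step k; have := step (k + 1).
  case=> E1 [] E2; rewrite E1 E2 //; case: neq; apply/eqP; rewrite -subr_eq0.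
    by rewrite -(subrK (s (k + 1)) (s (k + 1 + 1))) -addrA E1 E2.
  by rewrite -(subrK (s (k + 1)) (s (k + 1 + 1))) -addrA E1 E2.
have stepC m : s (m%:R + 1) - s m%:R = s 1 - s 0.
  elim: m => [|m IH]; first by rewrite add0r.
  by rewrite -natr1 stepE.
move=> i; rewrite sE; congr u; rewrite -[i]natr_Zp; elim: (val i) => [|m IH].
  by rewrite mulr0 addr0.
by rewrite -natr1 -(subrK (s m%:R) (s _)) stepC IH; ring.
Qed.

(** The edge {i, i + 1} goes to the edge of index c + i or c - 1 - i, and windows
    are symmetric, so the same permutation works at all levels. *)
Lemma window_perm (mu : {rmorphism algC -> algC}) : exists2 t : 'I_5 -> 'I_5,
  injective t & forall n i, mu (window n i) = window n (t i).
Proof.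
have [c [e [[]-> muE]]] := dihedral mu.
  exists (fun i => c + i) => [|n]; first exact: addrI.
  elim: n => [|n IH] i /=; first by rewrite rmorphM !muE !mul1r addrA.
  by rewrite !rmorphM !IH !addrA.
exists (fun i => c - 1 - i) => [i j /addrI/oppr_inj //|n].
elim: n => [|n IH] i /=.
  rewrite rmorphM !muE mulrC; congr (u _ * u _).
    by rewrite mulN1r opprD addrA addrAC.
  by rewrite mulN1r [RHS]addrAC subrK.
rewrite !rmorphM !IH -mulrA mulrC [X in X * _]mulrC.
congr (window n _ * _ * window n _); first by rewrite opprD addrA.
by rewrite opprB addrA addrAC.
Qed.

Lemma mahler_window n : mahler `|window n 0| = `|window n.+1 0|.
Proof.
have real_w : window n 0 \is Num.real.
  apply: real_unique_max => [mu|i]; last exact: window_max.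
  by have [t _ tE] := window_perm mu; exists t.
rewrite mahler_norm_real ?Aint_window //.
have f_perm (mu : {rmorphism algC -> algC}) : exists s : 'I_5 -> 'I_5,
    [/\ injective s, {in [set: 'I_5], forall i, s i \in [set: 'I_5]}
      & {in [set: 'I_5], forall i, mu (window n i) = window n (s i)}].
  by have [s s_inj sE] := window_perm mu; exists s; split=> // j _; rewrite ?inE.
have := mahler_family f_perm (in_setT 0) (Aint_window n 0).
rewrite (_ : [set j in _ | _] = [set 0]) ?cards1 ?expr1; last first.
  apply/setP=> j; rewrite !inE; have [->|j0] := eqVneq j 0; first exact: eqxx.
  by apply: contraTF (window_max n j0) => /eqP->; rewrite ltxx.
move=> -> => [|j _]; last first.
  by have [mu muE] := window_shift j; exists mu; rewrite muE add0r.
transitivity (\prod_j Num.max 1 `|window n j|).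
  by apply: eq_bigl => j; rewrite inE.
have [w0 w1 w4 w2 w3] := patternP n.
rewrite prod_ord5 (max1_gt1 w0) (max1_gt1 w1) (max1_gt1 w4) (max1_lt1 w2) (max1_lt1 w3).
rewrite windowS !mulr1 !add0r (_ : - 1 = 4 :> 'I_5) //; first by ring.
exact: val_inj.
Qed.

Lemma wandering_cyclic i : wandering (u i).
Proof.
apply: (@wandering_increasing _ (fun n => `|window n 0|)) => n.
  have [w0 w1 w4 w2 w3] := patternP n.
  rewrite windowS !add0r (_ : - 1 = 4 :> 'I_5); last exact: val_inj.
  by rewrite mulrAC ltr_pMl ?w_gt0 // mulr_egt1.
elim: n => [|n IH]; last by rewrite iterS IH mahler_window.
by rewrite /= mahler_start normrM add0r.
Qed.

End Cyclic.

Section Complete.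

Variables (mu0 : {rmorphism algC -> algC}) (s0 : 'I_5 -> 'I_5).
Hypotheses (mu0E : forall i, mu0 (u i) = u (s0 i)) (s0_inj : injective s0).
Hypothesis nonadjacent : s0 1 - s0 0 <> 1 /\ s0 1 - s0 0 <> - 1.

(** Up to a shift every pair is {0, d} with d nonzero.  The shifts of the pair
    {0, 1} give d = 1 and d = -1, those of its image under mu0 give d = 2 and
    d = -2. *)
Lemma pair_conj (i j : 'I_5) : i != j -> exists mu : {rmorphism algC -> algC},
  mu (u 0 * u 1) = u i * u j.
Proof.
have shift (k i' j' : 'I_5) (mu : {rmorphism algC -> algC}) :
    mu (u 0 * u 1) = u i' * u j' ->
  exists mu' : {rmorphism algC -> algC}, mu' (u 0 * u 1) = u (i' + k) * u (j' + k).
  have [nuk nukE] := shift_aut k => E; exists (nuk \o mu).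
  by rewrite /= E rmorphM !nukE.
pose E d := exists mu : {rmorphism algC -> algC}, mu (u 0 * u 1) = u 0 * u d.
have EN d : E d -> E (- d).
  case=> mu /(shift (- d))[mu' E']; exists mu'.
  by rewrite E' add0r subrr mulrC.
have E1 : E 1 by exists idfun.
have Es : E (s0 1 - s0 0).
  have [|mu' E'] := @shift (- s0 0) (s0 0) (s0 1) mu0.
    by rewrite rmorphM !mu0E.
  by exists mu'; rewrite E' subrr.
have Ed d : d != 0 -> E d.
  have E4 := EN _ E1; have sN0 : s0 1 - s0 0 <> 0.
    by move/eqP; rewrite subr_eq0 => /eqP/s0_inj.
  have E4' : - 1 = 4 :> 'I_5 by apply: val_inj.
  have E23 : - (2) = 3 :> 'I_5 by apply: val_inj.
  have E32 : - (3) = 2 :> 'I_5 by apply: val_inj.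
  have [E2 E3] : E 2 /\ E 3.
    case: nonadjacent; rewrite E4' in E4 *.
    move: (s0 1 - s0 0) Es sN0; elim/ord5P => // /[dup] /EN; rewrite ?E23 ?E32; auto.
  by elim/ord5P: d => // _; rewrite -?E4'.
move=> ij; have [mu /(shift i)[mu' E']] : E (j - i).
  by apply: Ed; rewrite subr_eq0 eq_sym.
by exists mu'; rewrite E' add0r subrK.
Qed.

Let y := `|u 0| * `|u 1|.

Lemma real_pair : u 0 * u 1 \is Num.real.
Proof.
have [s s_inj sE] := u_perm Num.conj.
rewrite CrealE rmorphM !sE; apply/eqP.
have : `|u (s 0)| * `|u (s 1)| = y.
  by rewrite -!sE !norm_conjC.
have ne : s 0 != s 1 by rewrite (inj_eq s_inj).
have [/(pair_max ne) + E|] := boolP ((2 <= s 0%R)%N || (2 <= s 1%R)%N).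
  by rewrite E ltxx.
rewrite negb_or -!ltnNge => /andP[]; move: ne.
elim/ord5P: (s 0) => //; elim/ord5P: (s 1) => // _ _ _ _.
by rewrite mulrC.
Qed.

Lemma y_gt1 : 1 < y.
Proof. by rewrite mulr_egt1 ?big_gt1. Qed.

(** Ordered pairs are used, which counts every conjugate twice.  Each of u_0 and
    u_1 lies in four of the seven large unordered pairs and each other u_j in
    two, and the product of all the u_j has modulus 1. *)
Lemma mahler_pair e : (0 < e)%N -> mahler (y ^+ e) = y ^+ e.*2.
Proof.
move=> e_gt0; have y1 := y_gt1; have y0 : 0 < y := lt_trans ltr01 y1.
pose D : {set 'I_5 * 'I_5} := [set p | p.1 != p.2].
pose f (p : 'I_5 * 'I_5) := (u p.1 * u p.2) ^+ e.
have D01 : (0, 1) \in D by rewrite inE.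
have Zf p : f p \in Aint by rewrite rpredX ?rpredM.
have -> : y ^+ e = `|f (0, 1)| by rewrite normrX normrM.
rewrite (mahler_norm_real (Zf _)) ?rpredX ?real_pair //.
have f_perm (mu : {rmorphism algC -> algC}) : exists s,
    [/\ injective s, {in D, forall p, s p \in D} & {in D, forall p, mu (f p) = f (s p)}].
  have [s s_inj sE] := u_perm mu; exists (fun p => (s p.1, s p.2)).
  split=> [[i j] [i' j'] [/s_inj-> /s_inj->] // | p | p _].
    by rewrite !inE /= (inj_eq s_inj).
  by rewrite rmorphXn rmorphM !sE.
have f_conj : {in D, forall p, is_conj (f (0, 1)) (f p)}.
  move=> p; rewrite inE => /pair_conj[mu muE]; exists mu.
  by rewrite rmorphXn muE.
have fiberE : [set p in D | f p == f (0, 1)] = [set (0, 1); (1, 0)].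
  apply/setP=> -[i j]; rewrite !inE /= !xpair_eqE.
  have [->|ij] := eqVneq i j; first by elim/ord5P: j.
  have [/(pair_max ij) lt_y|] := boolP ((2 <= i)%N || (2 <= j)%N); last first.
    rewrite negb_or -!ltnNge => /andP[]; move: ij.
    elim/ord5P: i => //; elim/ord5P: j => // _ _ _; first by rewrite eqxx.
    by rewrite /f /= mulrC eqxx.
  have -> : (f (i, j) == f (0, 1)) = false.
    apply: contraTF lt_y => /eqP/(congr1 (fun x => `|x|)).
    rewrite !normrX !normrM => /eqP; rewrite eqrXn2 ?mulr_ge0 // => /eqP->.
    by rewrite ltxx.
  apply/esym/negbTE; apply: contraTN lt_y => /orP[] /andP[/eqP-> /eqP->].
    by rewrite ltxx.
  by rewrite mulrC ltxx.
have := mahler_family f_perm D01 (Zf _) f_conj.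
rewrite fiberE cards2 /= => mahler2.
have prodE : \prod_(p in D) Num.max 1 `|f p| = (y ^+ e.*2) ^+ 2.
  transitivity ((\prod_(i : 'I_5) \prod_(j : 'I_5 | i != j)
      if (2 <= i)%N && (2 <= j)%N then 1 else `|u i| * `|u j|) ^+ e).
    rewrite (pair_big_dep xpredT (fun i j : 'I_5 => i != j)) /= -prodrXl.
    apply: eq_big => [p | [i j] /=]; rewrite !inE //= => ij.
    rewrite /f normrX normrM; case: ifP => [/andP[i2 j2] | /negbT].
      by rewrite expr1n max1_lt1 // exprn_ilt1 ?mulr_ge0 ?mulr_ilt1 ?small_lt1 -?lt0n.
    rewrite negb_and -!ltnNge => ij2; rewrite max1_gt1 // exprn_egt1 -?lt0n //.
    have [i1|i2] := ltnP i 2; have [j1|j2] := ltnP j 2.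
    - by rewrite mulr_egt1 ?big_gt1.
    - exact: mixed_gt1.
    - by rewrite mulrC mixed_gt1.
    by move: ij2; rewrite (ltnNge i) i2 (ltnNge j) j2.
  under eq_bigr do rewrite big_mkcond.
  have -> : (y ^+ e.*2) ^+ 2 = (y ^+ 4) ^+ e by rewrite -!exprM; congr (_ ^+ _); lia.
  rewrite prod_ord5 !prod_ord5 /=; congr (_ ^+ e).
  have pa4 : (`|u 0| * `|u 1| * `|u 2| * `|u 3| * `|u 4|) ^+ 4 = 1.
    by rewrite -(prod_ord5 (fun i => `|u i|)) prod_abs_u expr1n.
  rewrite -[RHS]mulr1 -[X in _ = _ * X]pa4 /y.
  by ring.
apply/eqP; rewrite -(@eqrXn2 _ 2) ?exprn_ge0 ?(ltW y0) //; first by rewrite mahler2 prodE.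
rewrite /mahler mulr_ge0 // prodr_ge0 // => z _.
by rewrite /Order.max; case: ifP.
Qed.

Lemma wandering_complete i : wandering (u i).
Proof.
apply: (@wandering_increasing _ (fun n => y ^+ (2 ^ n))) => n.
  by rewrite ltr_eXn2l ?y_gt1 // ltn_exp2l.
elim: n => [|n IH]; first by rewrite /= mahler_start.
by rewrite iterS IH mahler_pair ?expn_gt0 // -mul2n -expnS.
Qed.

End Complete.

Lemma wandering_of_sign_pattern i : wandering (u i).
Proof.
pose adj (mu : {rmorphism algC -> algC}) (s : 'I_5 -> 'I_5) :=
  (forall i, mu (u i) = u (s i)) -> s 1 - s 0 = 1 \/ s 1 - s 0 = - 1.
have [cyc|] := boolp.pselect (forall mu s, adj mu s).
  exact: wandering_cyclic.
move/boolp.existsNP=> [mu] /boolp.existsNP[s] /boolp.not_implyP[sE].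
move=> /boolp.not_orP nadj; apply: (wandering_complete sE _ nadj).
have [t t_inj tE] := u_perm mu.
have ts j : t j = s j by apply: u_inj; rewrite -tE sE.
by move=> j k; rewrite -!ts => /t_inj.
Qed.
End SignPattern.

(** * The five-cycle *)

(** Orbits of a group of prime order p have size 1 or p, and an element of
    order p moves some point; on p points an orbit of size p is everything. *)
Lemma porbit_prime p (g : {perm 'I_p}) a : prime p -> #[g]%g = p -> porbit g a = setT.
Proof.
move=> p_pr og.
have card_orb i : #|porbit g i| = 1%N \/ porbit g i = setT.
  have : (#|porbit g i| %| p)%N by rewrite -[X in (_ %| X)%N]og porbitE dvdn_orbit.
  case/primeP: p_pr => _ dvp /dvp/pred2P[|Ep]; [by left | right].
  by apply/eqP; rewrite eqEcard finset.subsetT cardsT card_ord Ep leqnn.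
have [i gi] : exists i, g i != i.
  apply/existsP; apply: contraTT (prime_gt1 p_pr); rewrite negb_exists => /forallP fix_g.
  suff g1 : g = 1%g by rewrite -og g1 order1.
  by apply/permP=> i; rewrite perm1; apply/eqP; rewrite -[_ == _]negbK fix_g.
case: (card_orb i) => [/eqP/cards1P[j Ej] | Ei].
  have : i \in porbit g i by apply: porbit_id.
  have : g i \in porbit g i by apply: (mem_porbit g 1).
  by rewrite Ej !inE => /eqP gj /eqP ij; rewrite gj ij eqxx in gi.
have : a \in porbit g i by rewrite Ei inE.
by rewrite -eq_porbit_mem Ei => /eqP.
Qed.

Section Roots.

Variable r : 'I_5 -> algC.
Hypothesis r_inj : injective r.
Hypothesis r_perm : forall mu : {rmorphism algC -> algC},
  exists2 s : 'I_5 -> 'I_5, injective s & forall i, mu (r i) = r (s i).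
Hypothesis r_conj : forall i j, is_conj (r i) (r j).

(** The Galois group, realized on the indices of the roots. *)
Definition root_perms : {set {perm 'I_5}} :=
  [set s : {perm 'I_5} | boolp.asbool
     (exists mu : {rmorphism algC -> algC}, forall i, mu (r i) = r (s i))].

Lemma root_permsP (s : {perm 'I_5}) : reflect
  (exists mu : {rmorphism algC -> algC}, forall i, mu (r i) = r (s i)) (s \in root_perms).
Proof. by rewrite inE; apply: boolp.asboolP. Qed.

Lemma group_set_root_perms : group_set root_perms.
Proof.
apply/group_setP; split; first by apply/root_permsP; exists idfun => i; rewrite perm1.
move=> s t /root_permsP[mu muE] /root_permsP[nu nuE]; apply/root_permsP.
by exists (nu \o mu) => i; rewrite /= muE nuE permM.
Qed.

Canonical root_perms_group := Group group_set_root_perms.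

Lemma root_perms_trans i j : exists2 s, s \in root_perms & s i = j.
Proof.
have [mu muE] := r_conj i j; have [s s_inj sE] := r_perm mu.
exists (perm s_inj); first by apply/root_permsP; exists mu => k; rewrite permE sE.
by rewrite permE; apply: r_inj; rewrite -sE.
Qed.

(** The order of a transitive group on five points is divisible by 5, so by
    Cauchy's theorem it contains a 5-cycle; a suitable power of it sends a to b
    and is still a 5-cycle. *)
Lemma five_cycle a b : a != b -> exists nu : {rmorphism algC -> algC},
  exists2 e : 'I_5 -> 'I_5, injective e /\ (e 0 = a /\ e 1 = b)
    & forall i, nu (r (e i)) = r (e (i + 1)).
Proof.
move=> ab; have dvd5 : (5 %| #|root_perms|)%N.
  have tr : [transitive root_perms, on [set: 'I_5] | 'P].
    apply/imsetP; exists a; rewrite ?inE //.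
    apply/eqP; rewrite eq_sym eqEsubset subsetT /=.
    apply/subsetP=> j _; have [s Gs <-] := root_perms_trans a j.
    by apply/imsetP; exists s.
  by have := atrans_dvd tr; rewrite cardsT card_ord.
have [x Gx ox] := Cauchy (isT : prime 5) dvd5.
have : b \in porbit x a by rewrite porbit_prime ?inE.
case/porbitP=> k Eb; pose g := (x ^+ k)%g.
have Gg : g \in root_perms by rewrite groupX.
have og : #[g]%g = 5.
  have : (#[g]%g %| 5)%N by rewrite -[X in (_ %| X)%N]ox orderXdvd.
  case/primeP: (isT : prime 5) => _ /[apply] /pred2P[|//] /eqP.
  by rewrite order_eq1 => /eqP g1; move: ab; rewrite Eb -/g g1 perm1 eqxx.
have [nu nuE] := root_permsP _ Gg; exists nu.
pose e (i : 'I_5) := (g ^+ i)%g a.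
have e_surj j : exists i, e i = j.
  have : j \in porbit g a by rewrite porbit_prime ?inE.
  case/porbitP=> m ->; exists (inZp m); rewrite /e /=.
  by rewrite -(expg_mod_order g m) og.
have [f fK] := fin_all_exists e_surj.
have f_inj : injective f by apply: can_inj fK.
have [h fh hf] := injF_bij f_inj.
have eh i : e i = h i by rewrite -[in LHS](hf i) fK.
exists e; first split.
- by move=> i j; rewrite !eh => /(can_inj hf).
- by rewrite /e /= expg0 perm1 expg1 Eb.
move=> i; rewrite nuE -permM -expgSr /e /=; congr (r _).
rewrite -[in LHS](expg_mod_order g) og; congr ((g ^+ _)%g a).
by rewrite /= modnDmr addn1.
Qed.

(** Take two complex conjugate roots if there are any; otherwise all roots are
    real and any pair will do. *)
Lemma conj_stable_pair : exists a b : 'I_5, a != b /\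
  {in ~: [set a; b], forall j, exists2 k, k \in ~: [set a; b] & r k = (r j)^*}.
Proof.
have [c c_inj cE] := r_perm Num.conj.
have cK i : c (c i) = i by apply: r_inj; rewrite -!cE; apply: conjCK.
suff [a [b [ab cab]]] : exists a b : 'I_5,
    a != b /\ {in [set a; b], forall j, c j \in [set a; b]}.
  exists a, b; split=> // j; rewrite inE => nSj; exists (c j); last by rewrite cE.
  by rewrite inE; apply: contra nSj => /cab; rewrite cK.
have [/existsP[i ci] | fix_c] := boolP [exists i, c i != i].
  exists i, (c i); split; first by rewrite eq_sym.
  by move=> j; rewrite !inE => /orP[] /eqP->; rewrite ?cK eqxx ?orbT.
exists 0, 1; split=> // j Sj; move: fix_c; rewrite negb_exists => /forallP/(_ j).
by rewrite negbK => /eqP->.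
Qed.

Hypothesis Zr : forall i, r i \in Aint.
Hypothesis r_free : forall (P : {poly int}) i,
  P != 0 -> (size P <= 5)%N -> ev P (r i) != 0.

(** For the pair S of [conj_stable_pair] the weights are T^3 and T^-2, and
    |u_i u_j| and |u_i u_j u_k^2| are T and T^-3 up to the factors C^2 and C^4;
    hence the lower bound C^4 + C^2 for T. *)
Lemma wandering_quotient i0 : exists P Q : {poly int},
  [/\ ev P (r i0) != 0, ev Q (r i0) != 0,
      ev P (r i0) / ev Q (r i0) \in Aint,
      ev Q (r i0) / ev P (r i0) \in Aint
    & wandering (ev P (r i0) / ev Q (r i0))].
Proof.
have [a [b [ab conjS]]] := conj_stable_pair; set S := [set a; b] in conjS.
have [C] := exists_weighted_unit Zr r_perm r_free (isT : 0 < 5)%N conjS.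
case/(_ (C ^ 4 + C ^ 2)%N) => T ltCT [P [Q [nzPQ Zu Zv prod_u boundu]]].
have [nu [e [e_inj [e0 e1]] nuE]] := five_cycle ab.
pose u i := ev P (r (e i)) / ev Q (r (e i)).
have [f ef fe] := injF_bij e_inj.
have T_gt0 : (0 < T)%N by apply: leq_ltn_trans ltCT.
have cardS : #|S| = 2 by rewrite cards2 ab.
have w_big (i : 'I_5) : (i < 2)%N -> weight S T (e i) = T%:R ^+ 3.
  move=> i2; rewrite /weight cardS !inE.
  suff [->|->] : i = 0 \/ i = 1 by rewrite ?e0 ?e1 eqxx ?orbT.
  by move: i2; elim/ord5P: i; auto.
have w_small (i : 'I_5) : (2 <= i)%N -> weight S T (e i) = T%:R ^- 2.
  move=> i2; rewrite /weight cardS !inE -e0 -e1 !(inj_eq e_inj).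
  by move: i2; elim/ord5P: i.
have lt4 : C%:R ^+ 4 < T%:R :> algC.
  by rewrite -natrX ltr_nat; apply: leq_ltn_trans ltCT; apply: leq_addr.
have lt2 : C%:R ^+ 2 < T%:R :> algC.
  by rewrite -natrX ltr_nat; apply: leq_ltn_trans ltCT; apply: leq_addl.
have T0 : 0 < T%:R :> algC by rewrite ltr0n.
have C0 : 0 <= C%:R :> algC by rewrite ler0n.
have u_wand i : wandering (u i).
  apply: (@wandering_of_sign_pattern u _ nu).
  - move=> mu; have [s s_inj sE] := r_perm mu; exists (f \o s \o e).
      by do 2!apply: inj_comp => //; apply: can_inj fe.
    by move=> j; rewrite /u fmorph_div !ev_aut !sE /= fe.
  - by move=> j; rewrite /u fmorph_div !ev_aut !nuE.
  - by move=> j; apply: Zu.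
  - by rewrite -[RHS]prod_u [RHS](reindex_inj e_inj).
  - move=> j k j2 k2; have [_ gej] := boundu (e j); have [_ gek] := boundu (e k).
    rewrite w_big // in gej; rewrite w_small // in gek.
    have : T%:R <= C%:R ^+ 2 * (`|u j| * `|u k|).
      have -> : T%:R = T%:R ^+ 3 * T%:R ^- 2 :> algC by field; rewrite gt_eqF.
      have -> : C%:R ^+ 2 * (`|u j| * `|u k|) = (C%:R * `|u j|) * (C%:R * `|u k|) by ring.
      by rewrite ler_pM // ?exprn_ge0 ?invr_ge0 ?exprn_ge0 ?ltW.
    move/(lt_le_trans lt2); rewrite -{1}[C%:R ^+ 2]mulr1 ltr_pM2l // exprn_gt0 //.
    rewrite lt_neqAle C0 andbT eq_sym; apply: contraTneq gej => ->.
    by rewrite mul0r lt_geF // exprn_gt0.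
  move=> j k l j2 k2 l2.
  have [lej _] := boundu (e j); have [lek _] := boundu (e k).
  have [lel _] := boundu (e l).
  rewrite w_big // in lej; rewrite w_small // in lek; rewrite w_small // in lel.
  apply: (@le_lt_trans _ _
    ((C%:R * T%:R ^+ 3) * (C%:R * T%:R ^- 2) * (C%:R * T%:R ^- 2) ^+ 2)).
    by rewrite ler_pM ?mulr_ge0 ?exprn_ge0 ?ler_pM ?lerXn2r ?nnegrE //
      mulr_ge0 ?invr_ge0 ?exprn_ge0 ?ltW.
  have -> : C%:R * T%:R ^+ 3 * (C%:R * T%:R ^- 2) * (C%:R * T%:R ^- 2) ^+ 2
      = C%:R ^+ 4 / T%:R ^+ 3 :> algC by field; rewrite gt_eqF.
  rewrite ltr_pdivrMr ?exprn_gt0 // mul1r (lt_le_trans lt4) //.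
  by rewrite -[X in X <= _]expr1 ler_weXn2l // ler1n.
exists P, Q; have [nzP nzQ] := nzPQ i0; split=> //.
by have := u_wand (f i0); rewrite /u fe.
Qed.

End Roots.

(** * Quintic fields *)

(** If p has degree n and leading coefficient l, then l^(n-1) p(x) is a monic
    integer polynomial in l x. *)
Lemma Aint_scale (x : algC) : exists2 l : int, l != 0 & l%:~R * x \in Aint.
Proof.
have [_ lead_gt0 px0 _] := int_minpolyP x; move: (int_minpoly x) lead_gt0 px0 => p.
set l := lead_coef p => l_gt0 px0; have l0 : l != 0 by rewrite gt_eqF.
exists l => //; pose n := (size p).-1.
have szp : size p = n.+1.
  by rewrite prednK // lt0n size_poly_eq0 -lead_coef_eq0.
have n_gt0 : (0 < n)%N.
  rewrite lt0n; apply: contraTneq px0 => n0; rewrite /root (@horner_coef_wide _ 1).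
    rewrite big_ord1 expr0 mulr1 coef_map /= intr_eq0.
    by move: l0; rewrite /l lead_coefE szp n0.
  by rewrite size_map_inj_poly ?szp ?n0 //; apply: intr_inj.
pose q : {poly int} := 'X^n + \poly_(i < n) (p`_i * l ^+ (n.-1 - i)).
have mon_q : q \is monic.
  rewrite monicE lead_coefDl ?lead_coefXn //.
  by rewrite size_polyXn ltnS size_poly.
apply: (@root_monic_Aint (map_poly intr q)); last 2 first.
- by rewrite monicE lead_coef_map_inj ?(monicP mon_q) //; apply: intr_inj.
- by apply/polyOverP=> i; rewrite coef_map /= rpred_int.
apply/rootP; rewrite /q rmorphD rmorphXn /= map_polyX hornerD hornerXn.
rewrite (@horner_coef_wide _ n); last first.
  by rewrite size_map_inj_poly ?size_poly //; apply: intr_inj.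
move/rootP: px0; rewrite (@horner_coef_wide _ n.+1); last first.
  by rewrite size_map_inj_poly ?szp //; apply: intr_inj.
rewrite big_ord_recr /= coef_map /= -[p`_n](_ : l = _); last by rewrite /l lead_coefE szp.
move/(congr1 (fun z => l%:~R ^+ n.-1 * z)); rewrite mulr0 => E; rewrite -[RHS]E.
rewrite mulrDr addrC mulr_sumr; congr (_ + _).
  apply: eq_bigr => i _; rewrite !coef_map coef_poly ltn_ord /= rmorphM rmorphXn exprMn.
  have -> : l%:~R ^+ n.-1 = l%:~R ^+ (n.-1 - i) * l%:~R ^+ i :> algC.
    by rewrite -exprD subnK // -ltnS prednK.
  by ring.
by rewrite mulrA -exprSr prednK // exprMn.
Qed.

Lemma integral_of_Aint (K : fieldExtType rat) (iota : {rmorphism K -> algC}) x :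
  iota x \in Aint -> integralOver (intr : int -> K) x.
Proof.
move=> Zx; have /floorpP[q Dq] : minCpoly (iota x) \is a polyOver Num.int by exact: Zx.
exists q.
  have := minCpoly_monic (iota x); rewrite Dq !monicE lead_coef_map_inj //.
    by rewrite (eqr_int _ _ 1).
  exact: intr_inj.
rewrite -(fmorph_root iota) -map_poly_comp.
rewrite (@eq_map_poly _ _ _ intr); last by move=> z; rewrite /= rmorph_int.
by rewrite -Dq root_minCpoly.
Qed.

Lemma size_minCpoly_iota (K : fieldExtType rat) (iota : {rmorphism K -> algC}) x :
  size (minCpoly (iota x)) = (adjoin_degree 1%AS x).+1.
Proof.
have ratrK (q : {poly rat}) : map_poly iota (map_poly (in_alg K) q) = map_poly ratr q.
  by rewrite -map_poly_comp; apply: eq_map_poly => a; rewrite /= alg_num_field fmorph_rat.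
rewrite -size_minPoly; have [p [Dp mon_p] dv_p] := minCpolyP (iota x).
have /polyOver1P[q Dq] := minPolyOver 1%AS x.
rewrite Dp Dq !size_map_poly; apply/eqP; rewrite eqn_leq; apply/andP; split.
  apply: dvdp_leq.
    by rewrite -(map_poly_eq0 (in_alg K)) -Dq monic_neq0 ?monic_minPoly.
  by rewrite -dv_p -ratrK -Dq fmorph_root root_minPoly.
apply: dvdp_leq; first exact: monic_neq0.
rewrite -(dvdp_map (in_alg K)) -Dq minPoly_dvdp ?polyOver1P //.
  by apply/polyOver1P; exists p.
by rewrite -(fmorph_root iota) ratrK dv_p.
Qed.

(** The degree of K is prime, so every irrational element of K generates it; a
    multiple of such an element is an algebraic integer of degree five. *)
Theorem theorem1p1 (K : fieldExtType rat) (iota : {rmorphism K -> algC})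
    (degK : \dim {: K} = 5%N) :
  exists u : K, algebraic_unit u /\ wandering (iota u).
Proof.
have [x0 x0_notQ] : exists x0 : K, x0 \notin 1%VS.
  exists (vpick (1%VS : {vspace K})^C%VS); apply/negP=> Q_pick.
  have : vpick (1^C : {vspace K})%VS \in (1 :&: 1^C)%VS.
    by rewrite memv_cap Q_pick memv_pick.
  rewrite capv_compl memv0 vpick0 => /eqP C0.
  by have := dimv_compl (1 : {vspace K})%VS; rewrite C0 dimv0 dimv1 degK.
have [l nz_l Zx] := Aint_scale (iota x0); pose x := l%:~R * x0.
have nzl : l%:~R != 0 :> K by rewrite -(fmorph_eq0 iota) rmorph_int intr_eq0.
have x_notQ : x \notin 1%VS.
  apply: contra x0_notQ => Qx.
  have -> : x0 = l%:~R^-1 * x by rewrite mulKf.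
  by rewrite rpredM // rpredV rpred_int.
have {Zx} Zx : iota x \in Aint by rewrite rmorphM /= rmorph_int.
have deg_x : adjoin_degree 1%AS x = 5%N.
  have := adjoin_degreeE 1%AS x; rewrite dimv1 divn1 => ->.
  have : (\dim <<1; x>> %| 5)%N by rewrite -degK field_dimS ?subvf.
  case/primeP: (isT : prime 5) => _ /[apply] /pred2P[dim1|//].
  have /eqP E : (1%VS == <<1; x>>%VS) by rewrite eqEdim subv_adjoin dimv1 dim1.
  by move: x_notQ; rewrite E memv_adjoin.
have [s [Ds us sP]] := conj_roots (iota x).
have szs : size s = 5%N.
  by have := size_minCpoly_iota iota x; rewrite Ds size_prod_XsubC deg_x => -[].
pose r (i : 'I_5) := s`_i.
have rs i : r i \in s by rewrite mem_nth // szs.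
have r_inj : injective r.
  by move=> i j /eqP; rewrite nth_uniq ?szs // => /eqP/val_inj.
have r_surj y : y \in s -> exists i, r i = y.
  move=> sy; have lt_i : (index y s < 5)%N by rewrite -szs index_mem.
  by exists (Ordinal lt_i); rewrite /r nth_index.
have r_conj i j : is_conj (r i) (r j).
  have [mu Dmu] := is_conj_sym ((sP _).1 (rs i)); have [nu Dnu] := (sP _).1 (rs j).
  by exists (nu \o mu); rewrite /= Dmu.
have r_perm (mu : {rmorphism algC -> algC}) :
    exists2 t : 'I_5 -> 'I_5, injective t & forall i, mu (r i) = r (t i).
  have mu_s i : exists j, mu (r i) = r j.
    have [nu Dnu] := (sP _).1 (rs i).
    have [|j Dj] := r_surj (mu (r i)); last by exists j.
    by apply/sP; exists (mu \o nu); rewrite /= Dnu.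
  have [t tE] := fin_all_exists mu_s; exists t => // i j Eij.
  by apply: r_inj; apply: (fmorph_inj mu); rewrite !tE Eij.
have Zr i : r i \in Aint.
  by have [mu <-] := (sP _).1 (rs i); rewrite Aint_aut.
have r_free (P : {poly int}) i : P != 0 -> (size P <= 5)%N -> ev P (r i) != 0.
  move=> nzP szP; apply/negP=> Pri0.
  have sz6 : size (minCpoly (r i)) = 6%N.
    by have [mu <-] := (sP _).1 (rs i); rewrite minCpoly_aut Ds size_prod_XsubC szs.
  have [p [Dp mon_p] dv_p] := minCpolyP (r i).
  have dvP : p %| map_poly intr P.
    rewrite -dv_p -map_poly_comp (@eq_map_poly _ _ _ intr) //.
    by move=> z; rewrite /= ratr_int.
  have szP' : size (map_poly (intr : int -> rat) P) = size P.
    by rewrite size_map_inj_poly //; apply: intr_inj.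
  have := dvdp_leq _ dvP; rewrite szP' -size_poly_eq0 szP' size_poly_eq0 => /(_ nzP).
  by rewrite -(size_map_poly (ratr : {rmorphism rat -> algC})) -Dp sz6 leqNgt ltnS szP.
have [i0 Di0] : exists i, r i = iota x by apply: r_surj; apply/sP; exists idfun.
have [P [Q [nzP nzQ Zu Zv wand_u]]] :=
  wandering_quotient r_inj r_perm r_conj Zr r_free i0.
have evK (R : {poly int}) : ev R (r i0) = iota (map_poly intr R).[x].
  rewrite Di0 -horner_map -map_poly_comp /ev; congr (_.[_]).
  by apply: eq_map_poly => z; rewrite /= rmorph_int.
rewrite !evK in nzP nzQ Zu Zv wand_u; rewrite !fmorph_eq0 in nzP nzQ.
rewrite -!fmorph_div in Zu Zv wand_u.
exists ((map_poly intr P).[x] / (map_poly intr Q).[x]); split=> //.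
split; first exact: integral_of_Aint Zu.
exists ((map_poly intr Q).[x] / (map_poly intr P).[x]); first exact: integral_of_Aint Zv.
by rewrite mulf_div [X in X / _]mulrC divff // mulf_neq0.
Qed.
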